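(* There is a sequence of positive real numbers $(\gamma_n)_{n\geq 1}$ fulfilling $$\gamma_1=\frac12,\qquad \gamma_{3n+2}=\frac14,\qquad \gamma_{3n+3}+\gamma_{3n+4}=\frac12\qquad\text{for every integer } n\geq 0,$$ and $$\gamma_3=\frac{7}{30},\quad \gamma_4=\frac{4}{15},\quad \gamma_6=\frac{12}{49},\quad \gamma_7=\frac{25}{98},\quad \gamma_9=\frac{3187}{12870},\quad \gamma_{10}=\frac{1624}{6435},$$ such that the sequence of polynomials $(P_n)_{n\geq 0}$ given by $$P_0(x)=1,\qquad P_1(x)=x,\qquad P_{n+2}(x)=xP_{n+1}(x)-\gamma_{n+1}P_n(x)\quad (n\geq 0)$$ is orthogonal with respect to the weight function $$\frac{\left|x+\frac12\right|}{\sqrt{1+x}}+\frac{\left|x-\frac12\right|}{\sqrt{1-x}},\qquad -1<x<1.$$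
   Context: A sequence of polynomials $(P_n)_{n\geq 0}$ with $\deg P_n=n$ is orthogonal with respect to a weight function $v\geq 0$ on $(-1,1)$ if $\int_{-1}^{1}P_m(x)P_n(x)v(x)\,dx=0$ for all $m\neq n$ and $\int_{-1}^{1}P_n(x)^2v(x)\,dx\neq 0$ for all $n$. *)

(* Defs.v *)
From mathcomp Require Import all_boot all_order all_algebra.
From mathcomp Require Import all_classical all_reals all_analysis.
Set Implicit Arguments.
Unset Strict Implicit.
Unset Printing Implicit Defensive.
Import Order.TTheory GRing.Theory Num.Theory.
Import numFieldNormedType.Exports.
Local Open Scope classical_set_scope.
Local Open Scope ring_scope.

(* P_0 = 1, P_1 = X, P_{n+2} = X P_{n+1} - gamma_{n+1} P_n.  In the last branch
   the argument of the fixpoint is n.+2 and n1 = n.+1; [gamma 0] is unused. *)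
Fixpoint recurrence_poly (R : realType) (gamma : nat -> R) (k : nat) : {poly R} :=
  match k with
  | 0%N => 1
  | n1.+1 =>
      match n1 with
      | 0%N => 'X
      | n.+1 => 'X * recurrence_poly gamma n1 - gamma n1 *: recurrence_poly gamma n
      end
  end.

(* Integrability of P_m P_n v makes the Lebesgue integrals genuine: without it
   [Rintegral] could be 0 as a default value.  [size] is the degree plus one. *)
Definition orthogonal_polys (R : realType) (v : R -> R) (P : nat -> {poly R}) : Prop :=
  [/\ forall x : R, -1 < x -> x < 1 -> 0 <= v x,
      forall n : nat, size (P n) = n.+1,
      forall m n : nat, (@lebesgue_measure R).-integrable `]-1, 1[
        (fun x : R => ((P m).[x] * (P n).[x] * v x)%:E),
      forall m n : nat, m <> n ->
        Rintegral (@lebesgue_measure R) `]-1, 1[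
          (fun x : R => (P m).[x] * (P n).[x] * v x) = 0
    & forall n : nat,
        Rintegral (@lebesgue_measure R) `]-1, 1[
          (fun x : R => (P n).[x] ^+ 2 * v x) <> 0].

Definition weight (R : realType) (x : R) : R :=
  `|x + 1 / 2| / Num.sqrt (1 + x) + `|x - 1 / 2| / Num.sqrt (1 - x).

(* Main.v *)
From HB Require Import structures.
Require Import Defs.
From mathcomp Require Import all_boot all_order all_algebra.
From mathcomp Require Import all_classical all_reals all_analysis.
From mathcomp Require Import measurable_realfun.
From mathcomp Require Import zify ring lra.

(** Write [x = cos t].  Since [1 - cos 3t = (1 - x) (1 + 2x)^2] and
    [1 + cos 3t = (1 + x) (1 - 2x)^2], the weight times [dx] is, up to a
    constant, [(|sin (3t/2)| + |cos (3t/2)|) dt].  This density has period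
    [pi/3], so the Chebyshev moment of index [n] vanishes unless [6] divides [n]
    ([weight_form_cheb]).  Two consequences follow.

    The polynomials [T_i] with [i = a] or [i = -a] modulo [6] span a space
    [C_a], and distinct spaces are orthogonal ([chebspan_orth]).  On the other
    hand, for any numbers [g_k] with [g_0 = 0], the recurrence with coefficients
    [gamma_{3k} = g_k], [gamma_{3k+1} = 1/2 - g_k], [gamma_{3k+2} = 1/4] produces
    polynomials with [P_n] in [C_n] ([recurrence_poly_chebspan]): eliminating the
    intermediate terms over one period expresses [P_{3k+1}], [P_{3k+2}],
    [P_{3k+3}] through [T_1 P_{3k}], [T_2 P_{3k}], [T_3 P_{3k}] and one earlier
    polynomial of the right class.  Orthogonality of the sequence reduces to
    that of [P_{n+2}] and [P_n], which lie in different classes unless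
    [n = 2] modulo [3]; in that last case it is obtained by the choice
    [g_k = <P_{3k}, P_{3k}> / <P_{3k-1}, P_{3k-1}>] for [k >= 1]
    ([sieved_orth]).  The [gamma_n] are then ratios of squared norms, hence
    positive, and the listed values come from the moments of index [0], [6],
    [12], [18].

    The moments are computed by splitting the weight into [kern 1] and
    [kern (-1)], mirror images of each other, and by exhibiting antiderivatives
    of the form [sqrt (1 - x) h(x)] with [h] a polynomial, built from the
    Chebyshev polynomials of the third and fourth kinds ([cheb_primitiveP]).
    The integrands are unbounded at an endpoint, so integrability and the
    fundamental theorem of calculus are established first for an antiderivative
    that is merely continuous on the closed interval ([integrable_FTC],
    [Rintegral_FTC]). *)

Set Implicit Arguments.
Unset Strict Implicit.
Unset Printing Implicit Defensive.
Import Order.TTheory GRing.Theory Num.Theory.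
Import numFieldNormedType.Exports.
Local Open Scope classical_set_scope.
Local Open Scope ring_scope.

(** * Chebyshev polynomials *)

Fixpoint cheb (R : realType) (n : nat) : {poly R} :=
  match n with
  | 0%N => 1
  | n1.+1 =>
      match n1 with
      | 0%N => 'X
      | n2.+1 => 2 * 'X * cheb R n1 - cheb R n2
      end
  end.

Lemma chebSS (R : realType) (n : nat) :
  cheb R n.+2 = 2 * 'X * cheb R n.+1 - cheb R n.
Proof. by []. Qed.

(** The identity [2 cos a cos b = cos (a + b) + cos (a - b)], proved by a
    simultaneous induction on two consecutive values of [j] for all [m]. *)
Lemma mul_cheb_add (R : realType) (j m : nat) :
  2 * (cheb R (m + j) * cheb R j) = cheb R (m + j.*2) + cheb R m.
Proof.
suff: forall m, 2 * (cheb R (m + j) * cheb R j) = cheb R (m + j.*2) + cheb R m /\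
    2 * (cheb R (m + j.+1) * cheb R j.+1) = cheb R (m + j.+1.*2) + cheb R m.
  by move=> /(_ m)[].
elim: j => [|j IH] {}m.
  rewrite !doubleS double0 !addnS !addn0; split=> /=; ring.
split; first by have [] := IH m.
have [_ IH1] := IH m.+1; have [IH0 _] := IH m.+2.
rewrite ?(doubleS, addnS, addSn) in IH0 IH1 *.
rewrite (chebSS R j).
transitivity (2 * 'X * (2 * (cheb R (m + j).+2 * cheb R j.+1)) -
   2 * (cheb R (m + j).+2 * cheb R j)); first by ring.
rewrite IH1 IH0.
rewrite (chebSS _ (m + j.*2).+2) (chebSS _ m).
ring.
Qed.

(** The second index is [|i - j|], written with truncated subtractions. *)
Lemma mul_cheb (R : realType) (i j : nat) :
  2 * (cheb R i * cheb R j) = cheb R (i + j) + cheb R ((i - j) + (j - i)).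
Proof.
wlog ji : i j / (j <= i)%N.
  move=> H; case: (leqP j i) => ij; first exact: H.
  by rewrite [cheb R i * _]mulrC (H j i (ltnW ij)) addnC [X in _ + cheb R X]addnC.
have -> : (i - j + (j - i) = i - j)%N by lia.
rewrite -{1}(subnK ji) mul_cheb_add; congr (cheb _ _ + cheb _ _); lia.
Qed.

Lemma poly_horner_inj (R : realType) (p q : {poly R}) :
  (forall x, p.[x] = q.[x]) -> p = q.
Proof.
move=> pq; apply/eqP; rewrite -subr_eq0; apply/negPn/negP => d0.
pose rs := [seq i%:R : R | i <- iota 0 (size (p - q))].
have := @max_poly_roots R (p - q) rs d0.
rewrite size_map size_iota ltnn => H.
suff: false by []; apply: H.
  by apply/allP => x _; rewrite rootE hornerD hornerN pq subrr.
rewrite map_inj_uniq ?iota_uniq// => a b /eqP.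
by rewrite eqr_nat => /eqP.
Qed.

Lemma mul_chebE (R : realType) (i j : nat) :
  cheb R i * cheb R j =
  (1 / 2) *: (cheb R (i + j) + cheb R ((i - j) + (j - i))).
Proof.
apply: poly_horner_inj => x; rewrite hornerZ -mul_cheb !hornerE /=.
by field.
Qed.

Lemma cheb_opp (R : realType) (n : nat) (x : R) :
  (cheb R n).[- x] = (-1) ^+ n * (cheb R n).[x].
Proof.
elim/ltn_ind: n => -[|[|n]] IH.
- by rewrite /= !hornerE; ring.
- by rewrite /= !hornerE; ring.
rewrite !chebSS !hornerE /= (IH n.+1)// (IH n)// !exprS; by ring.
Qed.

Arguments cheb : simpl never.

(** * Classes of Chebyshev indices modulo 6, up to sign *)

(** The distance from [n] to the nearest multiple of 6.  Two indices share it
    exactly when they agree modulo 6 up to sign. *)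
Definition res6 (n : nat) : nat := minn (n %% 6) (6 - n %% 6).

Inductive chebspan (R : realType) (a : nat) : {poly R} -> Prop :=
| chebspan_cheb i : res6 i = res6 a -> chebspan a (cheb R i)
| chebspan0 : chebspan a 0
| chebspanD p q : chebspan a p -> chebspan a q -> chebspan a (p + q)
| chebspanZ c p : chebspan a p -> chebspan a (c *: p).

Lemma chebspanB (R : realType) a (p q : {poly R}) :
  chebspan a p -> chebspan a q -> chebspan a (p - q).
Proof.
by move=> hp hq; rewrite -scaleN1r; apply: chebspanD => //; apply: chebspanZ.
Qed.

Lemma chebspan_eq (R : realType) a b (p : {poly R}) :
  res6 a = res6 b -> chebspan a p -> chebspan b p.
Proof.
move=> ab; elim=> [i ia||q r _ ? _ ?|c q _ ?].
- by apply: chebspan_cheb; rewrite ia.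
- exact: chebspan0.
- exact: chebspanD.
- exact: chebspanZ.
Qed.

(** Both [i + j] and [|i - j|] lie in the class of [a + j] when [i] lies in the
    class of [a], because [a = -a] modulo 6 for a multiple [a] of 3. *)
Lemma chebspan_mul (R : realType) (a j : nat) (p : {poly R}) :
  (3 %| a)%N -> chebspan a p -> chebspan (a + j) (cheb R j * p).
Proof.
move=> a3; elim=> [i ia||q r _ ? _ ?|c q _ ?].
- rewrite mul_chebE; apply: chebspanZ; apply: chebspanD; apply: chebspan_cheb;
    move: ia a3; rewrite /res6; lia.
- by rewrite mulr0; exact: chebspan0.
- by rewrite mulrDr; exact: chebspanD.
- by rewrite -scalerAr; exact: chebspanZ.
Qed.

(** The product [T_i T_j] only involves the indices [i + j] and [|i - j|], and
    neither is divisible by 6 when [i] and [j] are in different classes. *)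
Lemma chebspan_orth (R : realType) (L : {scalar {poly R}}) a b (p q : {poly R}) :
  (forall n, ~~ (6 %| n)%N -> L (cheb R n) = 0) ->
  res6 a <> res6 b -> chebspan a p -> chebspan b q -> L (p * q) = 0.
Proof.
move=> L0 ab ap bq; elim: ap => [i ia||r s _ IHr _ IHs|c r _ IHr].
- elim: bq => [j jb||r s _ IHr _ IHs|c r _ IHr].
  + rewrite mul_chebE linearZ/= linearD/= !L0 ?addr0 ?mulr0//;
    move: ia jb ab; rewrite /res6; lia.
  + by rewrite mulr0 linear0.
  + by rewrite mulrDr linearD/= IHr IHs addr0.
  + by rewrite -scalerAr linearZ/= IHr mulr0.
- by rewrite mul0r linear0.
- by rewrite mulrDl linearD/= IHr IHs addr0.
- by rewrite -scalerAl linearZ/= IHr mulr0.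
Qed.

(** * Recurrences with sieved coefficients *)

Definition sieved_gamma (R : realType) (g : nat -> R) (n : nat) : R :=
  match (n %% 3)%N with
  | 0%N => g (n %/ 3)%N
  | 1%N => 1 / 2 - g (n %/ 3)%N
  | _ => 1 / 4
  end.

Lemma sieved_gamma0 (R : realType) (g : nat -> R) k :
  sieved_gamma g (3 * k) = g k.
Proof. by rewrite /sieved_gamma mulnC modnMl mulnK. Qed.

Lemma sieved_gamma1 (R : realType) (g : nat -> R) k :
  sieved_gamma g (3 * k).+1 = 1 / 2 - g k.
Proof.
rewrite /sieved_gamma.
have -> : ((3 * k).+1 %% 3 = 1)%N by lia.
by have -> : ((3 * k).+1 %/ 3 = k)%N by lia.
Qed.

Lemma sieved_gamma2 (R : realType) (g : nat -> R) k :
  sieved_gamma g (3 * k).+2 = 1 / 4.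
Proof.
rewrite /sieved_gamma.
by have -> : ((3 * k).+2 %% 3 = 2)%N by lia.
Qed.

Lemma recurrence_polySS (R : realType) (g : nat -> R) n :
  recurrence_poly g n.+2 = 'X * recurrence_poly g n.+1 - g n.+1 *: recurrence_poly g n.
Proof. by []. Qed.

Lemma size_recurrence_poly (R : realType) (g : nat -> R) n :
  recurrence_poly g n \is monic /\ size (recurrence_poly g n) = n.+1.
Proof.
elim/ltn_ind: n => -[|[|n]] IH.
- by rewrite /= monic1 size_poly1.
- by rewrite /= monicX size_polyX.
have [m1 s1] := IH n.+1 (leqnn _); have [_ s0] := IH n (ltnW (leqnn _)).
have sX : size ('X * recurrence_poly g n.+1) = n.+3.
  by rewrite size_monicM ?monicX ?monic_neq0// s1 size_polyX.
have lt : (size (- (g n.+1 *: recurrence_poly g n))%R < size ('X * recurrence_poly g n.+1)%R)%N.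
  by rewrite size_polyN sX (leq_ltn_trans (size_scale_leq _ _))// s0.
rewrite recurrence_polySS; split; last by rewrite size_polyDl.
by rewrite monicE lead_coefDl// -monicE monicMl ?monicX.
Qed.

(** Five steps of the recurrence, with coefficients [c], [1/4], [b], [1/2 - b],
    [1/4], in which the intermediate polynomials are eliminated; here
    [T_2 = 2 X^2 - 1] and [T_3 = 4 X^3 - 3 X].  When [p0] has index [3k],
    the indices of [p3], [p5], [p6] are [3k+3], [3k+5], [3k+6], and that of
    [p1] is [3k+1], opposite to [3k+5] modulo 6. *)
Lemma sieved_step (R : realType) (b c : R) (p0 p1 : {poly R}) :
  let p2 := 'X * p1 - c *: p0 in
  let p3 := 'X * p2 - (1 / 4) *: p1 in
  let p4 := 'X * p3 - b *: p2 in
  let p5 := 'X * p4 - (1 / 2 - b) *: p3 in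
  let p6 := 'X * p5 - (1 / 4) *: p4 in
  p5 = (1 / 2) *: (cheb R 2 * p3) - (b / 4) *: p1 /\
  p6 = (1 / 4) *: (cheb R 3 * p3) - (b * c / 4) *: p0.
Proof.
move=> p2 p3 p4 p5 p6; split; apply: poly_horner_inj => x;
  rewrite /p6 /p5 /p4 /p3 /p2 /= !hornerE /=; by field.
Qed.

(** By induction on blocks of four consecutive polynomials, starting at a
    multiple of 3.  The new polynomials are obtained from [P_{3k+3}] by
    multiplication by [T_1], [T_2], [T_3], up to the terms [P_{3k+2}],
    [P_{3k+1}], [P_{3k}], whose classes are those of [3k+4], [3k+5], [3k+6]. *)
Lemma recurrence_poly_chebspan (R : realType) (g : nat -> R) n :
  g 0%N = 0 -> chebspan n (recurrence_poly (sieved_gamma g) n).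
Proof.
move=> g0; set P := recurrence_poly _.
have g1 : sieved_gamma g 1 = 1 / 2 by rewrite (sieved_gamma1 g 0) g0 subr0.
have g2 : sieved_gamma g 2 = 1 / 4 by rewrite (sieved_gamma2 g 0).
have P2 : P 2%N = (1 / 2) *: cheb R 2.
  apply: poly_horner_inj => x.
  by rewrite /P recurrence_polySS g1 /= !hornerE /=; field.
have P3 : P 3%N = (1 / 4) *: cheb R 3.
  apply: poly_horner_inj => x.
  by rewrite /P recurrence_polySS -/P P2 g2 /= !hornerE /=; field.
suff H k : [/\ chebspan (3 * k) (P (3 * k)%N),
    chebspan (3 * k).+1 (P (3 * k).+1),
    chebspan (3 * k).+2 (P (3 * k).+2) &
    chebspan (3 * k).+3 (P (3 * k).+3)].
  have [H0 H1 H2 _] := H (n %/ 3)%N.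
  have [E|[E|E]] : (n = 3 * (n %/ 3) \/ n = (3 * (n %/ 3)).+1 \/
    n = (3 * (n %/ 3)).+2)%N by lia.
  - by rewrite E.
  - by rewrite E.
  - by rewrite E.
elim: k => [|k [H0 H1 H2 H3]].
  rewrite muln0 P2 P3; split; try (apply: chebspanZ).
  - exact: (@chebspan_cheb _ _ 0%N).
  - exact: (@chebspan_cheb _ _ 1%N).
  - exact: chebspan_cheb.
  - exact: chebspan_cheb.
have [E5 E6] := sieved_step (g k.+1) (sieved_gamma g (3 * k).+1)
  (P (3 * k)%N) (P (3 * k).+1).
have F2 : 'X * P (3 * k).+1 - sieved_gamma g (3 * k).+1 *: P (3 * k)%N
  = P (3 * k).+2 by [].
have E3 : (3 * k).+3 = (3 * k.+1)%N by lia.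
have F3 : 'X * P (3 * k).+2 - (1 / 4) *: P (3 * k).+1 = P (3 * k).+3.
  by rewrite -(sieved_gamma2 g k).
have F4 : 'X * P (3 * k).+3 - g k.+1 *: P (3 * k).+2 = P (3 * k).+4.
  by rewrite -(sieved_gamma0 g) -E3.
have F5 : 'X * P (3 * k).+4 - (1 / 2 - g k.+1) *: P (3 * k).+3 = P (3 * k).+3.+2.
  by rewrite -(sieved_gamma1 g) -E3.
have F6 : 'X * P (3 * k).+3.+2 - (1 / 4) *: P (3 * k).+4 = P (3 * k).+3.+3.
  by rewrite -(sieved_gamma2 g k.+1) -E3.
rewrite F2 F3 F4 F5 F6 in E5 E6.
have dvd3 : (3 %| (3 * k).+3)%N by lia.
rewrite -E3; split=> //.
- rewrite -F4; apply: chebspanB.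
    by have := chebspan_mul 1 dvd3 H3; rewrite addn1.
  by apply: chebspanZ; apply: chebspan_eq H2; rewrite /res6; lia.
- rewrite E5; apply: chebspanB; apply: chebspanZ.
    by have := chebspan_mul 2 dvd3 H3; rewrite addn2.
  by apply: chebspan_eq H1; rewrite /res6; lia.
- rewrite E6; apply: chebspanB; apply: chebspanZ.
    by have := chebspan_mul 3 dvd3 H3; rewrite addn3.
  by apply: chebspan_eq H0; rewrite /res6; lia.
Qed.

(** The pairs [(P_{3k-1}, P_{3k})] with [P_{-1} = 0].  As [L 0 = 0] and
    division by zero gives zero, the quotient [b] vanishes at [k = 0], which
    is the value needed for [gamma_0 = 0] and [gamma_1 = 1/2]. *)
Fixpoint sieved_pair (R : realType) (L : {poly R} -> R) (k : nat) :
    {poly R} * {poly R} :=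
  match k with
  | 0%N => (0, 1)
  | k1.+1 =>
      let p := (sieved_pair L k1).1 in
      let q := (sieved_pair L k1).2 in
      let b := L (q * q) / L (p * p) in
      let r := 'X * q - b *: p in
      let s := 'X * r - (1 / 2 - b) *: q in
      (s, 'X * s - (1 / 4) *: r)
  end.

(** The coefficient [g_k] depends on [P_{3k-1}] and [P_{3k}], which in turn
    only depend on the earlier coefficients; the recursion is carried out on
    pairs of polynomials. *)
Lemma sieved_coef_exists (R : realType) (L : {scalar {poly R}}) :
  exists g : nat -> R, g 0%N = 0 /\
    let P := recurrence_poly (sieved_gamma g) in
    forall k, g k.+1 = L (P (3 * k).+3 * P (3 * k).+3) /
                       L (P (3 * k).+2 * P (3 * k).+2).
Proof.
pose st := sieved_pair L.
pose g k := L ((st k).2 * (st k).2) / L ((st k).1 * (st k).1).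
have g0 : g 0%N = 0 by rewrite /g /= mulr0 linear0 invr0 mulr0.
exists g; split=> // P k.
suff E j : st j.+1 = (P (3 * j).+2, P (3 * j).+3) by rewrite /g E.
have stS i : st i.+1 =
    (let r := 'X * (st i).2 - g i *: (st i).1 in
     let s := 'X * r - (1 / 2 - g i) *: (st i).2 in
     (s, 'X * s - (1 / 4) *: r)) by [].
elim: j => [|j IH].
  rewrite stS g0 /= scaler0 subr0 mulr1 /P.
  by rewrite /= (sieved_gamma1 g 0) (sieved_gamma2 g 0) g0.
rewrite stS IH /=.
have E3 : (3 * j.+1 = (3 * j).+3)%N by lia.
have F4 : P (3 * j).+4 = 'X * P (3 * j).+3 - g j.+1 *: P (3 * j).+2.
  by rewrite -(sieved_gamma0 g) E3.
have F5 : P (3 * j).+3.+2 = 'X * P (3 * j).+4 - (1 / 2 - g j.+1) *: P (3 * j).+3.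
  by rewrite -(sieved_gamma1 g) E3.
have F6 : P (3 * j).+3.+3 = 'X * P (3 * j).+3.+2 - (1 / 4) *: P (3 * j).+4.
  by rewrite -(sieved_gamma2 g j.+1) E3.
by rewrite E3 F6 F5 F4.
Qed.

(** * Orthogonality for a functional supported on the indices divisible by 6 *)

Lemma form_mulX_recurrence (R : realType) (L : {scalar {poly R}}) (g : nat -> R)
    (q : {poly R}) n :
  let P := recurrence_poly g in
  L (q * ('X * P n.+1)) = L (q * P n.+2) + g n.+1 * L (q * P n).
Proof.
move=> P.
have -> : 'X * P n.+1 = P n.+2 + g n.+1 *: P n by rewrite /P recurrence_polySS subrK.
by rewrite mulrDr linearD/= -scalerAr linearZ.
Qed.

Lemma recurrence_poly_neq0 (R : realType) (g : nat -> R) n :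
  recurrence_poly g n != 0.
Proof. by have [m _] := size_recurrence_poly g n; rewrite monic_neq0. Qed.

Section Orthogonality.
Context (R : realType) (L : {scalar {poly R}}) (g : nat -> R).
Hypothesis L_cheb0 : forall n, ~~ (6 %| n)%N -> L (cheb R n) = 0.
Hypothesis L_gt0 : forall p, p != 0 -> 0 < L (p * p).
Hypothesis g0 : g 0%N = 0.
Let P := recurrence_poly (sieved_gamma g).
Hypothesis gS : forall k, g k.+1 = L (P (3 * k).+3 * P (3 * k).+3) /
                       L (P (3 * k).+2 * P (3 * k).+2).

Lemma sieved_orth1 n : L (P n.+1 * P n) = 0.
Proof.
apply: (@chebspan_orth _ _ n.+1 n) => //; last 2 first.
- exact: recurrence_poly_chebspan.
- exact: recurrence_poly_chebspan.
by rewrite /res6; lia.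
Qed.

(** The only case in which [n + 2] and [n] are in the same class is
    [n = 2] modulo [3]; there
    [L (P_{n+2} P_n) = L (P_{n+1} P_{n+1}) - gamma_{n+1} L (P_n P_n)],
    and [gamma_{n+1}] is chosen to make this vanish. *)
Lemma sieved_orth2 n : L (P n.+2 * P n) = 0.
Proof.
have [n3|n3] := boolP (n %% 3 == 2)%N; last first.
  apply: (@chebspan_orth _ _ n.+2 n) => //; last 2 first.
  - exact: recurrence_poly_chebspan.
  - exact: recurrence_poly_chebspan.
  by move: n3; rewrite /res6; lia.
have -> : n = (3 * (n %/ 3)).+2 by lia.
set k := (n %/ 3)%N.
have orth : L (P (3 * k).+3 * P (3 * k).+1) = 0.
  apply: (@chebspan_orth _ _ (3 * k).+3 (3 * k).+1) => //; last 2 first.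
  - exact: recurrence_poly_chebspan.
  - exact: recurrence_poly_chebspan.
  by rewrite /res6; lia.
have := form_mulX_recurrence L (sieved_gamma g) (P (3 * k).+3) (3 * k).+1.
rewrite /= -/P orth mulr0 addr0 => E.
rewrite [P (3 * k).+4]/P recurrence_polySS -/P mulrBl linearB/=.
rewrite -scalerAl linearZ/= -mulrA mulrCA E.
have -> : sieved_gamma g (3 * k).+3 = g k.+1.
  by rewrite -(sieved_gamma0 g); congr sieved_gamma; lia.
by rewrite gS divfK ?subrr// gt_eqF// L_gt0// recurrence_poly_neq0.
Qed.

(** The usual symmetry argument: [L (X p q)] can be expanded with the recurrence
    on either factor, so the gap between the two indices reduces to
    smaller gaps, or to the same gap at smaller indices. *)
Lemma sieved_orth_lt d n : L (P (n + d.+1)%N * P n) = 0.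
Proof.
elim/ltn_ind: d n => -[|[|d]] IH n.
- by rewrite addn1 sieved_orth1.
- by rewrite addn2 sieved_orth2.
have IHd m : L (P (m + d).+1 * P m) = 0.
  by rewrite -addnS; apply: IH; rewrite ltnW.
have step m : L (P (m + d.+3)%N * P m) = L (P (m + d).+2 * ('X * P m)).
  have -> : P (m + d.+3)%N =
      'X * P (m + d).+2 - sieved_gamma g (m + d).+2 *: P (m + d).+1.
    by rewrite !addnS.
  rewrite mulrBl linearB/= -scalerAl linearZ/= IHd mulr0 subr0.
  by rewrite -mulrA mulrCA.
elim: n => [|n IHn].
  by have := IHd 1%N; rewrite step /P /= mulr1.
have := IHd n.+2; rewrite step form_mulX_recurrence -/P !addSn => ->.
by move: IHn; rewrite !addnS add0r => ->; rewrite mulr0.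
Qed.

Lemma sieved_orth m n : m <> n -> L (P m * P n) = 0.
Proof.
have [mn _|mn _|//] := ltngtP m n.
- by rewrite mulrC -(subnKC mn) addSnnS sieved_orth_lt.
- by rewrite -(subnKC mn) addSnnS sieved_orth_lt.
Qed.

(** Orthogonality gives [gamma_{n+1} L (P_n P_n) = L (P_{n+1} P_{n+1})]. *)
Lemma sieved_gamma_gt0 n : 0 < sieved_gamma g n.+1.
Proof.
have P_gt0 m : 0 < L (P m * P m) by apply: L_gt0; exact: recurrence_poly_neq0.
have E : sieved_gamma g n.+1 * L (P n * P n) = L (P n.+1 * P n.+1).
  have := form_mulX_recurrence L (sieved_gamma g) (P n) n.
  rewrite -/P /= [L (P n * P n.+2)]sieved_orth ?add0r; last by lia.
  move=> <-; case: n => [|n].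
    by rewrite /P /= mul1r mulrC.
  rewrite mulrCA [P n.+1 * _]mulrC mulrCA form_mulX_recurrence -/P /=.
  by rewrite sieved_orth2 mulr0 addr0.
by rewrite -(pmulr_lgt0 _ (P_gt0 n)) E.
Qed.

End Orthogonality.

(** * The first coefficients *)

Section Values.
Context (R : realType) (L : {scalar {poly R}}) (g : nat -> R) (C : R).
Hypothesis C0 : C != 0.
Hypothesis L_cheb : forall n, L (cheb R n) =
  if (6 %| n)%N then C / (9 - 4 * n%:R ^+ 2) else 0.
Hypothesis g0 : g 0%N = 0.
Let P := recurrence_poly (sieved_gamma g).
Hypothesis gS : forall k, g k.+1 = L (P (3 * k).+3 * P (3 * k).+3) /
                       L (P (3 * k).+2 * P (3 * k).+2).

Lemma form_chebM i j : L (cheb R i * cheb R j) =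
  (1 / 2) * (L (cheb R (i + j)) + L (cheb R ((i - j) + (j - i)))).
Proof. by rewrite mul_chebE linearZ/= linearD. Qed.

(** The polynomials up to index 9 are computed in the Chebyshev basis, where the
    squared norms only involve the moments of index 0, 6, 12, 18. *)
Lemma sieved_values : [/\ g 1%N = 7 / 30, g 2%N = 12 / 49 & g 3%N = 3187 / 12870].
Proof.
(* An opaque copy of the sequence keeps rewriting from expanding it. *)
have [T TE] : {T | T = cheb R} by exists (cheb R).
have TX n : 'X * T n.+1 = (1 / 2) *: (T n.+2 + T n).
  apply: poly_horner_inj => x; rewrite TE chebSS !hornerE /=; by field.
have TX0 : 'X * T 0%N = T 1%N by rewrite TE mulr1.
have step n p q c : sieved_gamma g n.+1 = c -> P n.+1 = p -> P n = q ->
    P n.+2 = 'X * p - c *: q.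
  by rewrite /P recurrence_polySS -/P => -> -> ->.
have P0 : P 0%N = cheb R 0 by [].
have P1 : P 1%N = cheb R 1 by [].
have G1 : sieved_gamma g 1 = 1 / 2 by rewrite (sieved_gamma1 g 0) g0 subr0.
have G2 : sieved_gamma g 2 = 1 / 4 by exact: (sieved_gamma2 g 0).
have P2 : P 2%N = (1 / 2) *: cheb R 2.
  rewrite (step _ _ _ _ G1 P1 P0) -TE.
  do 3! rewrite ?mulrDr -?scalerAr; rewrite ?TX ?TX0.
  by apply: poly_horner_inj => x; rewrite ?(hornerD, hornerZ, hornerN); field.
have P3 : P 3%N = (1 / 4) *: cheb R 3.
  rewrite (step _ _ _ _ G2 P2 P1) -TE.
  do 3! rewrite ?mulrDr -?scalerAr; rewrite ?TX ?TX0.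
  by apply: poly_horner_inj => x; rewrite ?(hornerD, hornerZ, hornerN); field.
have LT n : L (T n) = if (6 %| n)%N then C / (9 - 4 * n%:R ^+ 2) else 0.
  by rewrite TE.
have LTM i j : L (T i * T j) = (1 / 2) * (L (T (i + j)%N) + L (T ((i - j) + (j - i))%N)).
  by rewrite TE form_chebM.
have N2 : L (P 2 * P 2) = C * (1 / 72).
  (* Hiding the right-hand side protects it from the rewriting of products. *)
  rewrite P2 -TE; set v := RHS.
  rewrite ?(mulrDl, mulrDr, scalerDr) -?(scalerAl, scalerAr).
  rewrite ?linearD/= ?linearZ/= ?LTM /addn /subn /= !LT /= /v.
  by field.
have N3 : L (P 3 * P 3) = C * (7 / 2160).
  rewrite P3 -TE; set v := RHS.
  rewrite ?(mulrDl, mulrDr, scalerDr) -?(scalerAl, scalerAr).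
  rewrite ?linearD/= ?linearZ/= ?LTM /addn /subn /= !LT /= /v.
  by field.
have g1 : g 1%N = 7 / 30.
  by rewrite (gS 0) N2 N3; field.
have G3 : sieved_gamma g 3 = 7 / 30 by rewrite (sieved_gamma0 g 1) g1.
have P4 : P 4%N = (1 / 8) *: cheb R 4 + (1 / 120) *: cheb R 2.
  rewrite (step _ _ _ _ G3 P3 P2) -TE.
  do 3! rewrite ?mulrDr -?scalerAr; rewrite ?TX ?TX0.
  by apply: poly_horner_inj => x; rewrite ?(hornerD, hornerZ, hornerN); field.
have G4 : sieved_gamma g 4 = 4 / 15.
  by rewrite (sieved_gamma1 g 1) g1; field.
have P5 : P 5%N = (1 / 16) *: cheb R 5 + (1 / 240) *: cheb R 1.
  rewrite (step _ _ _ _ G4 P4 P3) -TE.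
  do 3! rewrite ?mulrDr -?scalerAr; rewrite ?TX ?TX0.
  by apply: poly_horner_inj => x; rewrite ?(hornerD, hornerZ, hornerN); field.
have G5 : sieved_gamma g 5 = 1 / 4 by exact: (sieved_gamma2 g 1).
have P6 : P 6%N = (1 / 32) *: cheb R 6 + (1 / 480) *: cheb R 0.
  rewrite (step _ _ _ _ G5 P5 P4) -TE.
  do 3! rewrite ?mulrDr -?scalerAr; rewrite ?TX ?TX0.
  by apply: poly_horner_inj => x; rewrite ?(hornerD, hornerZ, hornerN); field.
(* The denominators stay factored so that no large numeral is expanded. *)
have N5 : L (P 5 * P 5) = C * (7 / (180 * 180)).
  rewrite P5 -TE; set v := RHS.
  rewrite ?(mulrDl, mulrDr, scalerDr) -?(scalerAl, scalerAr).
  rewrite ?linearD/= ?linearZ/= ?LTM /addn /subn /= !LT /= /v.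
  by field.
have N6 : L (P 6 * P 6) = C * (1 / (140 * 135)).
  rewrite P6 -TE; set v := RHS.
  rewrite ?(mulrDl, mulrDr, scalerDr) -?(scalerAl, scalerAr).
  rewrite ?linearD/= ?linearZ/= ?LTM /addn /subn /= !LT /= /v.
  by field.
have g2 : g 2%N = 12 / 49.
  by rewrite (gS 1) N5 N6; field.
have G6 : sieved_gamma g 6 = 12 / 49 by rewrite (sieved_gamma0 g 2) g2.
have P7 : P 7%N = (1 / 64) *: (cheb R 7 + (1 / 49) *: cheb R 5
    + (10 / 147) *: cheb R 1).
  rewrite (step _ _ _ _ G6 P6 P5) -TE.
  do 3! rewrite ?mulrDr -?scalerAr; rewrite ?TX ?TX0.
  by apply: poly_horner_inj => x; rewrite ?(hornerD, hornerZ, hornerN); field.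
have G7 : sieved_gamma g 7 = 25 / 98.
  by rewrite (sieved_gamma1 g 2) g2; field.
have P8 : P 8%N = (1 / 128) *: (cheb R 8 + (1 / 49) *: cheb R 4
    + (10 / 147) *: cheb R 2).
  rewrite (step _ _ _ _ G7 P7 P6) -TE.
  do 3! rewrite ?mulrDr -?scalerAr; rewrite ?TX ?TX0.
  by apply: poly_horner_inj => x; rewrite ?(hornerD, hornerZ, hornerN); field.
have G8 : sieved_gamma g 8 = 1 / 4 by exact: (sieved_gamma2 g 2).
have P9 : P 9%N = (1 / 256) *: (cheb R 9 + (13 / 147) *: cheb R 3).
  rewrite (step _ _ _ _ G8 P8 P7) -TE.
  do 3! rewrite ?mulrDr -?scalerAr; rewrite ?TX ?TX0.
  by apply: poly_horner_inj => x; rewrite ?(hornerD, hornerZ, hornerN); field.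
have N8 : L (P 8 * P 8) = C * (1 / (672 * 441)).
  rewrite P8 -TE; set v := RHS.
  rewrite ?(mulrDl, mulrDr, scalerDr) -?(scalerAl, scalerAr).
  rewrite ?linearD/= ?linearZ/= ?LTM /addn /subn /= !LT /= /v.
  by field.
have N9 : L (P 9 * P 9) = C * (3187 / (90 * 143 * (672 * 441))).
  rewrite P9 -TE; set v := RHS.
  rewrite ?(mulrDl, mulrDr, scalerDr) -?(scalerAl, scalerAr).
  rewrite ?linearD/= ?linearZ/= ?LTM /addn /subn /= !LT /= /v.
  by field.
have g3 : g 3%N = 3187 / 12870.
  by rewrite (gS 2) N8 N9; field.
by [].
Qed.

End Values.

(** * A fundamental theorem of calculus for unbounded integrands *)

(** The integrand need not be bounded near the endpoints: the integral from [a]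
    to [x] and [F] are both continuous on the closed interval and have the same
    derivative inside, so the mean value theorem applies to their difference. *)
Lemma Rintegral_FTC (R : realType) (f F : R -> R) (a b : R) :
  a < b ->
  (@lebesgue_measure R).-integrable `[a, b] (EFin \o f) ->
  {in `]a, b[, continuous f} ->
  {within `[a, b], continuous F} ->
  (forall x, x \in `]a, b[ -> is_derive x 1 F (f x)) ->
  Rintegral (@lebesgue_measure R) `[a, b] f = F b - F a.
Proof.
move=> ab intf cf cF dF.
pose G x := parameterized_integral (@lebesgue_measure R) a x f.
have cG : {within `[a, b], continuous G}.
  exact: parameterized_integral_continuous (ltW ab) intf.
have dG x : x \in `]a, b[ -> is_derive x 1 G (f x).
  move=> xab; have /[!in_itv]/= /andP[ax xb] := xab.
  have [dG GE] := continuous_FTC1_closed xb intf ax (cf x xab).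
  apply: DeriveDef; first exact: dG.
  by rewrite -derive1E; exact: GE.
have [x|x|c _] := @MVT R (F \- G) (fun=> 0) a b ab.
- move=> xab; have := dF x xab; have := dG x xab => dGx dFx.
  by rewrite -(subrr (f x)); exact: is_deriveB.
- by apply: continuousB; [exact: cF|exact: cG].
rewrite mul0r /= => /eqP.
have -> : G a = 0 by rewrite /G /parameterized_integral set_itv1 Rintegral_set1.
rewrite -/(parameterized_integral _ _ _ _) -/(G b).
by move=> /eqP E; lra.
Qed.

(** On compact subintervals the integral of [f] is a difference of values of the
    bounded function [F]; monotone convergence extends the bound to the whole
    interval. *)
Lemma integrable_FTC (R : realType) (f F : R -> R) (a b : R) :
  a < b ->
  (forall x, x \in `]a, b[ -> 0 <= f x) ->
  {in `]a, b[, continuous f} ->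
  {within `[a, b], continuous F} ->
  (forall x, x \in `]a, b[ -> is_derive x 1 F (f x)) ->
  (@lebesgue_measure R).-integrable `[a, b] (EFin \o f).
Proof.
move=> ab f0 cf cF dF; set mu := @lebesgue_measure R.
have [M [_ FM]] : [bounded F x | x in `[a, b]].
  have /compact_bounded[M [_ mrt]] := continuous_compact cF (@segment_compact R a b).
  by exists M; split; rewrite ?num_real // => ? ? ? ?; exact: mrt.
pose N := `|M| + 1.
have FN x : x \in `[a, b] -> `|F x| <= N.
  move=> xab; apply: FM => //.
  by rewrite /N (le_lt_trans (ler_norm _))// ltrDl.
pose e n := (b - a) / n.+3%:R.
have e0 n : 0 < e n by rewrite divr_gt0// subr_gt0.
have e3 n : e n <= (b - a) / 3.
  by rewrite ler_wpM2l ?subr_ge0 ?(ltW ab)// lef_pV2 ?posrE// ler_nat.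
pose I n : set R := `[a + e n, b - e n]%classic.
have Iab n x : I n x -> x \in `]a, b[.
  rewrite /I /= in_itv/= => /andP[h1 h2]; have h := e0 n.
  by rewrite in_itv/=; apply/andP; split; lra.
have mf : measurable_fun `]a, b[ f.
  apply: subspace_continuous_measurable_fun => //.
  by apply: continuous_in_subspaceT => x; rewrite inE; exact: cf.
have II n : (\int[mu]_(x in I n) (f x)%:E <= (N + N)%:E)%E.
  have anbn : a + e n < b - e n by have := e3 n; have := ab; lra.
  have sub x : x \in `]a + e n, b - e n[ -> x \in `]a, b[.
    by move=> xI; apply: (Iab n); exact: subset_itv_oo_cc xI.
  have intI : mu.-integrable (I n) (EFin \o f).
    apply: continuous_compact_integrable; first exact: segment_compact.
    apply: continuous_in_subspaceT => x; rewrite inE => xI.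
    exact/cf/(Iab n).
  have subI : I n `<=` `[a, b].
    by move=> x /Iab; exact: subset_itv_oo_cc.
  have cFI : {within `[a + e n, b - e n], continuous F}.
    exact: continuous_subspaceW cF.
  have cfI : {in `]a + e n, b - e n[, continuous f} by move=> x /sub; exact: cf.
  have dFI x : x \in `]a + e n, b - e n[ -> is_derive x 1 F (f x).
    by move=> /sub; exact: dF.
  have E := Rintegral_FTC anbn intI cfI cFI dFI.
  rewrite -[leLHS]fineK; last first.
    by apply: integrable_fin_num; [exact: measurable_itv|exact: intI].
  rewrite lee_fin -/(Rintegral mu (I n) f) E.
  apply: le_trans (ler_norm _) _; apply: le_trans (ler_normB _ _) _.
  have := e0 n; have := e3 n => h1 h2.
  by apply: lerD; apply: FN; rewrite in_itv/=; apply/andP; split; lra.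
have UI : \bigcup_n I n = `]a, b[%classic.
  rewrite eqEsubset; split=> [x [n _ /Iab]//|x /=].
  rewrite in_itv/= => /andP[ax xb].
  pose m := Num.min (x - a) (b - x).
  have m0 : 0 < m by rewrite lt_min !subr_gt0 ax.
  have [n nm] : exists n : nat, (b - a) / m < n%:R.
    by exists (Num.bound ((b - a) / m)); rewrite archi_boundP// divr_ge0 ?subr_ge0 ?ltW.
  exists n => //; rewrite /I /= in_itv/=.
  have em : e n <= m.
    rewrite /e ler_pdivrMr ?ltr0n// mulrC -ler_pdivrMr//.
    by rewrite (le_trans (ltW nm))// ler_nat; lia.
  have [m1 m2] : m <= x - a /\ m <= b - x by rewrite !ge_min !lexx orbT.
  by apply/andP; split; lra.
have cvg : (\int[mu]_(x in I n) (f x)%:E @[n --> \oo] -->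
    \int[mu]_(x in `]a, b[) (f x)%:E)%E.
  rewrite -UI; apply: ge0_nondecreasing_set_cvg_integral.
  - move=> m n mn; rewrite subsetEset; apply: subset_itvScc; rewrite bnd_simp.
      by rewrite lerD2l /e ler_wpM2l ?subr_ge0 ?(ltW ab)// lef_pV2 ?posrE// ler_nat.
    by rewrite lerD2l lerN2 /e ler_wpM2l ?subr_ge0 ?(ltW ab)// lef_pV2 ?posrE// ler_nat.
  - by move=> n; exact: measurable_itv.
  - move=> n; apply/measurable_EFinP; apply: measurable_funS mf => //.
    exact: Iab.
  - by move=> n x /Iab xab; rewrite lee_fin f0.
apply/integrableP; split.
  by apply/measurable_EFinP; exact: measurable_fun_itv_cc mf.
rewrite integral_itv_bndoo; last first.
  by apply: measurableT_comp => //; apply/measurable_EFinP.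
rewrite (_ : (\int[mu]_(z in `]a, b[) _ = \int[mu]_(x in `]a, b[) (f x)%:E)%E); last first.
  apply: eq_integral => x; rewrite inE/= => xab.
  by rewrite /= ger0_norm// f0.
apply: (@le_lt_trans _ _ (N + N)%:E); last exact: ltry.
apply: (@cvge_le _ _ _ _ _ _ _ _ cvg).
by apply: nearW => n; exact: II.
Qed.

(** * Integrals against the two halves of the weight *)

(** For [s = 1] or [s = -1] these are the two mirror-image terms of the weight;
    [s] carries the reflection, so that each computation is done once. *)
Definition kern (R : realType) (s x : R) : R :=
  `|s * x - 1 / 2| / Num.sqrt (1 - s * x).

Lemma weightE (R : realType) (x : R) : weight x = kern 1 x + kern (-1) x.
Proof.
rewrite /weight /kern !mul1r mulN1r opprK addrC.
by rewrite -opprD normrN.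
Qed.

Lemma sign_cases (R : realType) (s : R) : s * s = 1 -> s = 1 \/ s = -1.
Proof.
rewrite -expr2 => /eqP; rewrite sqrf_eq1 => /orP[/eqP ->|/eqP ->]; by [left|right].
Qed.

Lemma sign_itv (R : realType) (s x : R) : s * s = 1 -> x \in `]-1, 1[ ->
  0 < 1 - s * x.
Proof.
move=> /sign_cases[->|->]; rewrite in_itv/= => /andP[h1 h2]; lra.
Qed.

Lemma continuous_scale (R : realType) (s : R) : continuous (fun x : R => s * x).
Proof. by move=> x; apply: cvgM; [exact: cvg_cst|exact: cvg_id]. Qed.

Lemma continuous_sqrt_lin (R : realType) (s : R) :
  continuous (fun x : R => Num.sqrt (1 - s * x)).
Proof.
move=> x; apply: (@continuous_comp _ _ _ (fun x => 1 - s * x) Num.sqrt);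
  last exact: sqrt_continuous.
by apply: cvgB; [exact: cvg_cst|exact: continuous_scale].
Qed.

Lemma continuous_horner_scale (R : realType) (s : R) (q : {poly R}) :
  continuous (fun x : R => q.[s * x]).
Proof.
move=> x; apply: (@continuous_comp _ _ _ (fun x => s * x) (horner q)).
  exact: continuous_scale.
exact: continuous_horner.
Qed.

Lemma is_derive_mull (R : realType) (k : R) (f : R -> R) (x df : R) :
  is_derive x 1 f df -> is_derive x 1 (fun y => k * f y) (k * df).
Proof. by move=> d; have e := is_deriveZ (W := R^o) k d; exact: e. Qed.

Lemma is_derive_mulf (R : realType) (f g : R -> R) (x df dg : R) :
  is_derive x 1 f df -> is_derive x 1 g dg ->
  is_derive x 1 (fun y => f y * g y) (f x * dg + g x * df).
Proof. by move=> d d'; have e := is_deriveM d d'; exact: e. Qed.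

Lemma is_derive_sqrt_lin (R : realType) (s x : R) : 0 < 1 - s * x ->
  is_derive x 1 (fun x : R => Num.sqrt (1 - s * x)) (- s / (2 * Num.sqrt (1 - s * x))).
Proof.
move=> h.
have d1 : is_derive x (1 : R) (fun x : R => 1 - s * x) (- s).
  have := is_derive_poly (1 - s *: 'X) x.
  rewrite (_ : horner _ = (fun x => 1 - s * x)); last first.
    by apply/funext => y; rewrite !hornerE.
  by move=> /trigger_derive; apply; rewrite derivB derivZ derivX -polyC1 derivC !hornerE.
have d2 := is_derive1_sqrt h.
have := @is_derive1_comp R Num.sqrt (fun x => 1 - s * x) x _ _ d2 d1.
by move=> /trigger_derive; apply; rewrite mulrC.
Qed.

Lemma is_derive_horner_scale (R : realType) (s x : R) (q : {poly R}) :
  is_derive x 1 (fun x : R => q.[s * x]) (s * q^`().[s * x]).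
Proof.
have d1 : is_derive x (1 : R) (fun x : R => s * x) s.
  have := is_derive_poly (s *: 'X) x.
  rewrite (_ : horner _ = (fun x => s * x)); last first.
    by apply/funext => y; rewrite !hornerE.
  by move=> /trigger_derive; apply; rewrite derivZ derivX !hornerE.
have := @is_derive1_comp R (horner q) (fun x => s * x) x _ _
  (is_derive_poly q (s * x)) d1.
by move=> /trigger_derive; apply; rewrite mulrC.
Qed.

Lemma integrable_inv_sqrt (R : realType) (s : R) : s * s = 1 ->
  (@lebesgue_measure R).-integrable `[-1, 1]
    (EFin \o (fun x => (Num.sqrt (1 - s * x))^-1)).
Proof.
move=> s1.
have r0 x : x \in `]-1, 1[ -> 0 < Num.sqrt (1 - s * x).
  by move=> /(sign_itv s1); rewrite sqrtr_gt0.
apply: (@integrable_FTC R _ (fun x => (-2 * s) * Num.sqrt (1 - s * x))).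
- lra.
- by move=> x /r0 h; rewrite invr_ge0 ltW.
- move=> x /r0 h; apply: cvgV; first by rewrite gt_eqF.
  exact: continuous_sqrt_lin.
- apply: continuous_subspaceT => x.
  by apply: cvgM; [exact: cvg_cst|exact: continuous_sqrt_lin].
- move=> x xI; have h := sign_itv s1 xI; have h2 := r0 x xI.
  have d := is_derive_sqrt_lin h.
  apply: (trigger_derive (is_derive_mull (-2 * s) d)).
  transitivity ((s * s) / Num.sqrt (1 - s * x)); last by rewrite s1 mul1r.
  by field; rewrite gt_eqF.
Qed.

Lemma integrable_poly_kern (R : realType) (s : R) (q : {poly R}) : s * s = 1 ->
  (@lebesgue_measure R).-integrable `[-1, 1]
    (EFin \o (fun x => q.[x] * kern s x)).
Proof.
move=> s1; set mu := @lebesgue_measure R.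
pose h x : R := q.[x] * `|s * x - 1 / 2|.
have ch : continuous h.
  move=> x; apply: cvgM; first exact: continuous_horner.
  apply: (@continuous_comp _ _ _ (fun x => s * x - 1 / 2) Num.norm).
    by apply: cvgB; [exact: continuous_scale|exact: cvg_cst].
  exact: norm_continuous.
pose r x := (Num.sqrt (1 - s * x))^-1.
have E : EFin \o (fun x => q.[x] * kern s x) = ((EFin \o h) \* (EFin \o r))%E.
  by apply/funext => x; rewrite /= /h /r /kern -EFinM mulrA.
rewrite E; apply: integrableMr.
- exact: measurable_itv.
- by apply: measurable_funS (continuous_measurable_fun ch).
- have /compact_bounded[M [_ mrt]] := continuous_compact
    (continuous_subspaceT ch) (@segment_compact R (-1) 1).
  by exists M; split; rewrite ?num_real // => ? ? ? ?; exact: mrt.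
- exact: integrable_inv_sqrt.
Qed.

(** The hypothesis on [h] says that [sqrt (1 - y) h(y)] has derivative
    [(y - 1/2) q(y) / sqrt (1 - y)]; the sign [e] resolves the absolute value. *)
Lemma Rintegral_kern_piece (R : realType) (s e a b : R) (q h : {poly R}) :
  s * s = 1 -> -1 <= a -> a < b -> b <= 1 ->
  (forall x, a < x -> x < b -> `|s * x - 1 / 2| = e * (s * x - 1 / 2)) ->
  (forall y : R, (1 - y) * h^`().[y] - h.[y] / 2 = (y - 1 / 2) * q.[y]) ->
  let H y := Num.sqrt (1 - y) * h.[y] in
  Rintegral (@lebesgue_measure R) `[a, b] (fun x => q.[s * x] * kern s x) =
  e * s * (H (s * b) - H (s * a)).
Proof.
move=> s1 a1 ab b1 es hq H.
have sub x : x \in `]a, b[ -> x \in `]-1, 1[.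
  by rewrite !in_itv/= => /andP[h1 h2]; apply/andP; split; lra.
rewrite mulrBr.
apply: (@Rintegral_FTC R _ (fun x => (e * s) * H (s * x))) => //.
- have := @integrable_poly_kern R s (q \Po (s *: 'X)) s1.
  rewrite (_ : (fun x => _) = (fun x => q.[s * x] * kern s x)); last first.
    by apply/funext => x; rewrite horner_comp hornerZ hornerX.
  apply: integrableS; [exact: measurable_itv|exact: measurable_itv|].
  by apply: subset_itvScc; rewrite bnd_simp.
- move=> x /sub xI; have h0 := sign_itv s1 xI.
  apply: cvgM; first exact: continuous_horner_scale.
  apply: cvgM.
    apply: (@continuous_comp _ _ _ (fun x => s * x - 1 / 2) Num.norm).
      by apply: cvgB; [exact: continuous_scale|exact: cvg_cst].
    exact: norm_continuous.
  apply: cvgV; first by rewrite gt_eqF// sqrtr_gt0.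
  exact: continuous_sqrt_lin.
- apply: continuous_subspaceT => x; apply: cvgM; first exact: cvg_cst.
  apply: cvgM; first exact: continuous_sqrt_lin.
  exact: continuous_horner_scale.
- move=> x xab; have xI := sub x xab; have h0 := sign_itv s1 xI.
  have d1 := is_derive_sqrt_lin h0; have d2 := is_derive_horner_scale s x h.
  have r0 : 0 < Num.sqrt (1 - s * x) by rewrite sqrtr_gt0.
  have r2 := sqr_sqrtr (ltW h0).
  have hqx := hq (s * x).
  move: xab; rewrite in_itv/= => /andP[ax xb].
  apply: (trigger_derive (is_derive_mull (e * s) (is_derive_mulf d1 d2))).
  rewrite /kern es//.
  move: r0 r2; set r := Num.sqrt _ => r0 r2; clearbody r.
  transitivity (e * ((s * x - 1 / 2) * q.[s * x]) / r); last first.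
    by field; rewrite gt_eqF.
  rewrite -hqx -r2.
  transitivity (e * (s * s) * (r * h^`().[s * x] - h.[s * x] / (2 * r))).
    by field; rewrite gt_eqF.
  by rewrite s1; field; rewrite gt_eqF.
Qed.

(** The absolute value changes sign at [s/2]; the two pieces add up to
    [H 1 + H (-1) - 2 H (1/2)] for [H y = sqrt (1 - y) h(y)], whichever the
    sign of [s]. *)
Lemma Rintegral_kern (R : realType) (s : R) (q h : {poly R}) : s * s = 1 ->
  (forall y : R, (1 - y) * h^`().[y] - h.[y] / 2 = (y - 1 / 2) * q.[y]) ->
  Rintegral (@lebesgue_measure R) `[-1, 1] (fun x => q.[s * x] * kern s x) =
  Num.sqrt 2 * (h.[-1] - h.[1 / 2]).
Proof.
move=> s1 hq.
pose H y := Num.sqrt (1 - y) * h.[y].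
have H1 : H 1 = 0 by rewrite /H subrr sqrtr0 mul0r.
have HN1 : H (-1) = Num.sqrt 2 * h.[-1] by rewrite /H opprK.
have Hh : H (1 / 2) * 2 = Num.sqrt 2 * h.[1 / 2].
  rewrite /H mulrAC; congr (_ * _).
  have <- : Num.sqrt ((1 - 1 / 2) * 2 ^+ 2) = Num.sqrt 2 :> R.
    by congr Num.sqrt; field.
  by rewrite sqrtrM ?sqrtr_sqr ?ger0_norm//; lra.
have c1 : -1 < s / 2 /\ s / 2 < 1 by case: (sign_cases s1) => ->; split; lra.
have signL x : -1 < x -> x < s / 2 -> `|s * x - 1 / 2| = - s * (s * x - 1 / 2).
  case: (sign_cases s1) => -> h1 h2; first by rewrite ler0_norm; lra.
  by rewrite ger0_norm; lra.
have signR x : s / 2 < x -> x < 1 -> `|s * x - 1 / 2| = s * (s * x - 1 / 2).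
  case: (sign_cases s1) => -> h1 h2; first by rewrite ger0_norm; lra.
  by rewrite ler0_norm; lra.
have sh : s * (s / 2) = 1 / 2 by rewrite mulrA s1.
have left : Rintegral (@lebesgue_measure R) `[-1, s / 2]
    (fun x => q.[s * x] * kern s x) = H (- s) - H (1 / 2).
  rewrite (@Rintegral_kern_piece R s (- s) (-1) (s / 2) q h)//; last exact: ltW c1.2.
    by rewrite sh mulNr s1 mulrN1 -/(H (1 / 2)) -/(H (- s)) mulN1r opprB.
  exact: c1.1.
have right : Rintegral (@lebesgue_measure R) `[s / 2, 1]
    (fun x => q.[s * x] * kern s x) = H s - H (1 / 2).
  rewrite (@Rintegral_kern_piece R s s (s / 2) 1 q h)//; last exact: c1.2.
    by rewrite sh s1 mulr1 -/(H (1 / 2)) -/(H s) mul1r.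
  exact: ltW c1.1.
have i : (@lebesgue_measure R).-integrable `[-1, 1]
    (EFin \o (fun x => q.[s * x] * kern s x)).
  have := @integrable_poly_kern R s (q \Po (s *: 'X)) s1.
  rewrite (_ : (fun x => _) = (fun x => q.[s * x] * kern s x))//.
  by apply/funext => x; rewrite horner_comp hornerZ hornerX.
have E : (BLeft (-1 : R) <= BRight (s / 2))%O /\ (BRight (s / 2) <= BRight (1 : R))%O.
  by rewrite !bnd_simp; split; apply: ltW; case: c1.
have := @Rintegral_itvB R _ _ _ (s / 2) i E.1 E.2.
rewrite Rintegral_itv_obnd_cbnd; last first.
  apply: integrableS i => //; apply: subset_itvr; rewrite bnd_simp.
  exact: ltW c1.1.
rewrite left right mulrBr -HN1 -Hh => /eqP; rewrite subr_eq => /eqP ->.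
case: (sign_cases s1) => ->; rewrite ?opprK H1; ring.
Qed.

(** * Chebyshev moments of the weight *)

(** With [y = cos t], the two components of index [k] are
    [cos ((k - 3/2) t) / cos (t/2)] and [sin ((k - 3/2) t) / sin (t/2)], that
    is, Chebyshev polynomials of the third and fourth kinds.  The index is
    shifted by two so that [cheb_cheb34] holds from [n = 0] on. *)
Fixpoint cheb34 (R : realType) (k : nat) : {poly R} * {poly R} :=
  match k with
  | 0%N => (2 *: 'X - 1%:P, - (2 *: 'X + 1%:P))
  | k1.+1 =>
      let v := (cheb34 R k1).1 in
      let w := (cheb34 R k1).2 in
      ('X * v - (1%:P - 'X) * w, 'X * w + (1%:P + 'X) * v)
  end.

(** The derivatives with respect to [t] of [sin ((k - 3/2) t)] and
    [cos ((k - 3/2) t)], rewritten in terms of [y = cos t]. *)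
Lemma cheb34_deriv (R : realType) (k : nat) (y : R) :
  let v := (cheb34 R k).1 in
  let w := (cheb34 R k).2 in
  (1 - y) * w^`().[y] = w.[y] / 2 - (k%:R - 3 / 2) * v.[y] /\
  (1 + y) * v^`().[y] = - v.[y] / 2 + (k%:R - 3 / 2) * w.[y].
Proof.
elim: k => [|k [IHw IHv]] v w.
  rewrite /v /w /= !(derivD, derivB, derivN, derivZ, derivX, derivC) !hornerE /=.
  by split; field.
rewrite /v /w /=; move: IHw IHv.
move: (cheb34 R k).1 (cheb34 R k).2 => p q.
rewrite !(derivD, derivB, derivN, derivM, derivX, derivC) !hornerE /=.
set p' := p^`().[y]; set q' := q^`().[y] => Ep Eq.
rewrite -(@natr1 R k).
split.
  transitivity ((1 - y) * (q.[y] + p.[y]) + y * ((1 - y) * q') + (1 - y) * ((1 + y) * p')).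
    by ring.
  by rewrite Ep Eq; field.
transitivity ((1 + y) * (q.[y] + p.[y]) + y * ((1 + y) * p') - (1 + y) * ((1 - y) * q')).
  by ring.
by rewrite Ep Eq; field.
Qed.

Lemma cheb34_v3 (R : realType) (k : nat) (y : R) :
  (cheb34 R k.+2).1.[y] = 2 * y * (cheb34 R k.+1).1.[y] - (cheb34 R k).1.[y].
Proof.
rewrite /=; move: (cheb34 R k).1 (cheb34 R k).2 => p q.
by rewrite !hornerE /=; ring.
Qed.

(** The identity [2 cos (n t) cos (3t/2) = cos ((n + 3/2) t) + cos ((n - 3/2) t)]
    divided by [cos (t/2)]. *)
Lemma cheb_cheb34 (R : realType) (n : nat) (y : R) :
  2 * (cheb R n).[y] * (2 * y - 1) = (cheb34 R (n + 3)).1.[y] + (cheb34 R n).1.[y].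
Proof.
elim/ltn_ind: n => -[|[|n]] IH.
- by rewrite !cheb34_v3 /= !hornerE /=; ring.
- by rewrite -[(1 + 3)%N]/4%N !cheb34_v3 /= !hornerE /=; ring.
have IH1 := IH n.+1 (leqnn _); have IH0 := IH n (ltnW (leqnn _)).
rewrite !addSn !cheb34_v3 chebSS.
rewrite !addSn in IH0 IH1.
transitivity (2 * y * (2 * (cheb R n.+1).[y] * (2 * y - 1)) -
  2 * (cheb R n).[y] * (2 * y - 1)).
  by rewrite !hornerE /=; ring.
by rewrite IH1 IH0; ring.
Qed.

Lemma cheb34_half3 (R : realType) (k : nat) :
  (cheb34 R (k + 3)).2.[1 / 2] = - (cheb34 R k).2.[1 / 2].
Proof.
rewrite addn3 /=; move: (cheb34 R k).1 (cheb34 R k).2 => p q.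
by rewrite !hornerE /=; field.
Qed.

Lemma cheb34_N1 (R : realType) (k : nat) :
  (cheb34 R k).2.[-1] = (-1) ^+ k.
Proof.
elim: k => [|k IH]; first by rewrite /= !hornerE /=; ring.
by rewrite /= !hornerE /= IH exprS; ring.
Qed.

(** The function [sqrt (1 - y)] times this polynomial is an antiderivative of
    [(y - 1/2) T_n(y) / sqrt (1 - y)]; it comes from integrating [cos (n t)
    cos (3t/2)] termwise. *)
Definition cheb_primitive (R : realType) (n : nat) : {poly R} :=
  (- 1 / (2 * (2 * n%:R + 3))) *: (cheb34 R (n + 3)).2 +
  (- 1 / (2 * (2 * n%:R - 3))) *: (cheb34 R n).2.

Lemma two_n_sub3_neq0 (R : realType) (n : nat) : 2 * n%:R - 3 != 0 :> R.
Proof. by rewrite subr_eq0 -natrM eqr_nat; apply/eqP; lia. Qed.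

Lemma two_n_add3_neq0 (R : realType) (n : nat) : 2 * n%:R + 3 != 0 :> R.
Proof. by rewrite -natrM -natrD pnatr_eq0; lia. Qed.

Lemma cheb_primitiveP (R : realType) (n : nat) (y : R) :
  (1 - y) * (cheb_primitive R n)^`().[y] - (cheb_primitive R n).[y] / 2 =
  (y - 1 / 2) * (cheb R n).[y].
Proof.
have [E1 _] := cheb34_deriv n y; have [E2 _] := cheb34_deriv (n + 3) y.
have E3 := cheb_cheb34 n y.
have n0 := two_n_sub3_neq0 R n; have n1 := two_n_add3_neq0 R n.
rewrite /cheb_primitive derivD !derivZ !hornerD !hornerZ.
rewrite natrD in E2.
transitivity (- 1 / (2 * (2 * n%:R + 3)) * ((1 - y) * (cheb34 R (n + 3)).2^`().[y])
  + - 1 / (2 * (2 * n%:R - 3)) * ((1 - y) * (cheb34 R n).2^`().[y])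
  - (- 1 / (2 * (2 * n%:R + 3)) * (cheb34 R (n + 3)).2.[y]
  + - 1 / (2 * (2 * n%:R - 3)) * (cheb34 R n).2.[y]) / 2); first by ring.
rewrite E1 E2.
transitivity (((cheb34 R (n + 3)).1.[y] + (cheb34 R n).1.[y]) / 4).
  by field; rewrite n0 n1.
by rewrite -E3; field.
Qed.

Lemma cheb_primitive_bounds (R : realType) (n : nat) :
  (cheb_primitive R n).[-1] - (cheb_primitive R n).[1 / 2] =
  3 * ((-1) ^+ n - (cheb34 R n).2.[1 / 2]) / (9 - 4 * n%:R ^+ 2).
Proof.
have n0 := two_n_sub3_neq0 R n; have n1 := two_n_add3_neq0 R n.
rewrite /cheb_primitive !hornerD !hornerZ !cheb34_N1 cheb34_half3.
rewrite exprD.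
have -> : 9 - 4 * n%:R ^+ 2 = - ((2 * n%:R - 3) * (2 * n%:R + 3)) :> R by ring.
by field; rewrite n0 n1.
Qed.

Lemma cheb34_half6 (R : realType) (q k : nat) :
  (cheb34 R (q * 6 + k)).2.[1 / 2] = (cheb34 R k).2.[1 / 2].
Proof.
elim: q => [//|q IH].
have -> : (q.+1 * 6 + k = q * 6 + k + 3 + 3)%N by lia.
by rewrite !cheb34_half3 opprK.
Qed.

(** At [y = 1/2], where [t = pi/3], the sequence [sin ((k - 3/2) t) / sin (t/2)]
    has period 6. *)
Lemma cheb34_half_even (R : realType) (n : nat) : ~~ odd n ->
  (-1) ^+ n - (cheb34 R n).2.[1 / 2] = if (6 %| n)%N then 3 else 0.
Proof.
move=> on; rewrite -signr_odd (negbTE on) expr0.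
rewrite {1}(divn_eq n 6) cheb34_half6.
have [E|[E|E]] : (n %% 6 = 0 \/ n %% 6 = 2 \/ n %% 6 = 4)%N by lia.
- have -> : (6 %| n)%N by rewrite /dvdn E.
  by rewrite E /= !hornerE /=; field.
- have -> : (6 %| n)%N = false by rewrite /dvdn E.
  by rewrite E /= !hornerE /=; field.
- have -> : (6 %| n)%N = false by rewrite /dvdn E.
  by rewrite E -[4%N]/(1 + 3)%N cheb34_half3 /= !hornerE /=; field.
Qed.

Lemma integrable_poly_weight_cc (R : realType) (p : {poly R}) :
  (@lebesgue_measure R).-integrable `[-1, 1]
    (EFin \o (fun x => p.[x] * weight x)).
Proof.
have -> : EFin \o (fun x => p.[x] * weight x) =
    ((EFin \o (fun x => p.[x] * kern 1 x)%R) \+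
     (EFin \o (fun x => p.[x] * kern (-1) x)%R))%E.
  by apply/funext => x /=; rewrite weightE mulrDr EFinD.
apply: integrableD; first exact: measurable_itv.
  by apply: integrable_poly_kern; rewrite mulr1.
by apply: integrable_poly_kern; rewrite mulrNN mulr1.
Qed.

Lemma integrable_poly_weight (R : realType) (p : {poly R}) :
  (@lebesgue_measure R).-integrable `]-1, 1[
    (EFin \o (fun x => p.[x] * weight x)).
Proof.
apply: integrableS (integrable_poly_weight_cc p);
  [exact: measurable_itv..|exact: subset_itv_oo_cc].
Qed.

Definition weight_form (R : realType) (p : {poly R}) : R :=
  Rintegral (@lebesgue_measure R) `]-1, 1[ (fun x => p.[x] * weight x).

Lemma weight_form_scalar (R : realType) : scalar (@weight_form R).
Proof.
move=> a p q; rewrite /weight_form.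
have ip := integrable_poly_weight p; have iq := integrable_poly_weight q.
have iap : (@lebesgue_measure R).-integrable `]-1, 1[
    (EFin \o (fun x => a * (p.[x] * weight x))).
  have := integrable_poly_weight (a *: p).
  rewrite (_ : (fun x => _) = (fun x => a * (p.[x] * weight x)))//.
  by apply/funext => x; rewrite hornerZ mulrA.
rewrite -RintegralZl// -RintegralD//.
by apply: eq_Rintegral => x _; rewrite hornerD hornerZ mulrDl mulrA.
Qed.

HB.instance Definition _ (R : realType) :=
  GRing.isLinear.Build R {poly R} R *%R (@weight_form R) (@weight_form_scalar R).

(** The two halves of the weight contribute the same amount up to the factor
    [(-1)^n], by parity of [T_n]. *)
Lemma weight_form_cheb (R : realType) (n : nat) :
  weight_form (cheb R n) =
  if (6 %| n)%N then (18 * Num.sqrt 2) / (9 - 4 * n%:R ^+ 2) else 0.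
Proof.
have k1 := @Rintegral_kern R 1 _ _ (mulr1 1) (@cheb_primitiveP R n).
have kN : (-1) * (-1) = 1 :> R by rewrite mulrNN mulr1.
have k2 := Rintegral_kern kN (cheb_primitiveP n).
have i1 := integrable_poly_kern (cheb R n) (mulr1 1).
have i2 := integrable_poly_kern (cheb R n) kN.
have -> : weight_form (cheb R n) =
    Rintegral (@lebesgue_measure R) `[-1, 1] (fun x => (cheb R n).[x] * kern 1 x) +
    Rintegral (@lebesgue_measure R) `[-1, 1] (fun x => (cheb R n).[x] * kern (-1) x).
  rewrite -RintegralD//.
  rewrite /weight_form.
  rewrite Rintegral_itv_obnd_cbnd; last exact: integrable_poly_weight.
  rewrite Rintegral_itv_bndo_bndc.
    by apply: eq_Rintegral => x _; rewrite weightE mulrDr.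
  apply: integrableS (integrable_poly_weight_cc (cheb R n));
    [exact: measurable_itv..|exact: subset_itv_co_cc].
have -> : Rintegral (@lebesgue_measure R) `[-1, 1]
    (fun x => (cheb R n).[x] * kern 1 x) =
    Num.sqrt 2 * ((cheb_primitive R n).[-1] - (cheb_primitive R n).[1 / 2]).
  by rewrite -k1; apply: eq_Rintegral => x _; rewrite mul1r.
have -> : Rintegral (@lebesgue_measure R) `[-1, 1]
    (fun x => (cheb R n).[x] * kern (-1) x) = (-1) ^+ n *
    (Num.sqrt 2 * ((cheb_primitive R n).[-1] - (cheb_primitive R n).[1 / 2])).
  rewrite -k2 (_ : Rintegral (@lebesgue_measure R) `[-1, 1]
      (fun x => (cheb R n).[-1 * x] * kern (-1) x) =
      (-1) ^+ n * Rintegral (@lebesgue_measure R) `[-1, 1]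
      (fun x => (cheb R n).[x] * kern (-1) x)); first by rewrite signrMK.
  rewrite -RintegralZl//.
  by apply: eq_Rintegral => x _; rewrite mulN1r cheb_opp -mulrA.
rewrite cheb_primitive_bounds; have [on|on] := boolP (odd n).
  have -> : (6 %| n)%N = false by lia.
  have -> : (-1) ^+ n = -1 :> R by rewrite -signr_odd on expr1.
  by rewrite mulN1r subrr.
rewrite cheb34_half_even// -signr_odd (negbTE on) expr0 mul1r.
case: ifP => _; last by rewrite mulr0 mul0r mulr0 addr0.
have n0 := two_n_sub3_neq0 R n; have n1 := two_n_add3_neq0 R n.
have -> : 9 - 4 * n%:R ^+ 2 = - ((2 * n%:R - 3) * (2 * n%:R + 3)) :> R by ring.
by field; rewrite n0 n1.
Qed.

Lemma weight_gt0 (R : realType) (x : R) : -1 < x -> x < 1 -> 0 < weight x.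
Proof.
move=> h1 h2; have p1 : 0 < Num.sqrt (1 + x) by rewrite sqrtr_gt0; lra.
have p2 : 0 < Num.sqrt (1 - x) by rewrite sqrtr_gt0; lra.
have [x0|x0] := eqVneq x (1 / 2).
  apply: ltr_wpDr; first by rewrite divr_ge0// ltW.
  by rewrite divr_gt0// normr_gt0 x0; apply/eqP; lra.
apply: ltr_wpDl; first by rewrite divr_ge0// ltW.
by rewrite divr_gt0// normr_gt0 subr_eq0.
Qed.

(** If the integral of [p^2 w] vanished, then [p^2 w] would vanish almost
    everywhere; but it is positive on a ball around any point of the interval
    that is not a root of [p]. *)
Lemma weight_form_gt0 (R : realType) (p : {poly R}) :
  p != 0 -> 0 < weight_form (p * p).
Proof.
move=> p0; set mu := @lebesgue_measure R.
pose D : set R := `]-1, 1[%classic.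
pose f x := (p * p).[x] * weight x.
have f0 x : x \in `]-1, 1[ -> 0 <= f x.
  rewrite in_itv/= => /andP[h1 h2].
  by rewrite /f hornerM -expr2 mulr_ge0 ?sqr_ge0// ltW// weight_gt0.
have intf : mu.-integrable `]-1, 1[ (EFin \o f) := integrable_poly_weight (p * p).
have ge0 : 0 <= weight_form (p * p).
  by apply: Rintegral_ge0 => x; exact: f0.
rewrite lt_neqAle ge0 andbT eq_sym; apply/negP => /eqP I0.
have : (\int[mu]_(x in D) `|(f x)%:E| = 0)%E.
  have fin : (\int[mu]_(x in D) (f x)%:E \is a fin_num)%E.
    by apply: integrable_fin_num; [exact: measurable_itv|exact: intf].
  rewrite -[RHS]/(0%:E) -I0 /weight_form /Rintegral fineK; last exact: fin.
  apply: eq_integral => x; rewrite inE => xI.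
  by rewrite /= ger0_norm// f0.
have mD : measurable D by exact: measurable_itv.
move=> /(ae_eq_integral_abs mu mD (measurable_int mu intf)) ae0.
have [N [mN N0 sub]] := ae0.
have [x0 [x01 px0]] : exists x : R, (x \in `]-1, 1[) /\ p.[x] != 0.
  apply: contrapT => nex.
  have allroot x : x \in `]-1, 1[ -> p.[x] = 0.
    move=> xI; apply: contrapT => /eqP px; apply: nex; by exists x.
  (* More points of the interval than [p] can have roots. *)
  pose rs := [seq (i.+2%:R)^-1 : R | i <- iota 0 (size p)].
  have := @max_poly_roots R p rs p0.
  rewrite size_map size_iota ltnn => F; suff: false by []; apply: F.
    apply/allP => _ /mapP[i _ ->]; rewrite rootE allroot//.
    have i2 : (2 : R) <= i.+2%:R by rewrite ler_nat.
    rewrite in_itv/=; apply/andP; split.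
      by apply: (@lt_trans _ _ 0); rewrite ?invr_gt0; lra.
    by rewrite invf_lt1; lra.
  rewrite map_inj_uniq ?iota_uniq// => i j /invr_inj/eqP.
  by rewrite eqr_nat => /eqP[].
have near_x0 : \forall x \near x0, (x \in `]-1, 1[) /\ p.[x] != 0.
  apply: filterI; first exact: near_in_itvoo.
  have H := cvgr_neq0 p.[x0] (@continuous_horner R p x0) px0.
  by apply: H; exact: nbhs_filter.
have [e /= e0 ballN] := (nbhs_ballP _ _).1 near_x0.
have : (lebesgue_measure (ball x0 e) <= 0)%E.
  rewrite -N0; apply: le_measure; rewrite ?inE//; first exact: measurable_ball.
  move=> x /ballN[xI px]; apply: sub => /= xN.
  have := xN xI => -[] /eqP.
  move: (xI); rewrite in_itv/= => /andP[h1 h2].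
  by rewrite /f hornerM !mulf_eq0 (negbTE px)/= gt_eqF// weight_gt0.
rewrite lebesgue_measure_ball ?(ltW e0)// lee_fin mulr2n => ?; lra.
Qed.

(** * The orthogonality theorem *)

Theorem mainTheorem1 (R : realType) :
  exists gamma : nat -> R,
    (forall n : nat, (1 <= n)%N -> 0 < gamma n) /\
    (gamma 1%N = 1 / 2 /\
     (forall n : nat, gamma (3 * n + 2)%N = 1 / 4) /\
     (forall n : nat, gamma (3 * n + 3)%N + gamma (3 * n + 4)%N = 1 / 2)) /\
    (gamma 3%N = 7 / 30 /\ gamma 4%N = 4 / 15 /\
     gamma 6%N = 12 / 49 /\ gamma 7%N = 25 / 98 /\
     gamma 9%N = 3187 / 12870 /\ gamma 10%N = 1624 / 6435) /\
    orthogonal_polys (@weight R) (recurrence_poly gamma).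
Proof.
pose L : {scalar {poly R}} := @weight_form R.
have [g [g0 gS]] := sieved_coef_exists L.
have L_gt0 (p : {poly R}) : p != 0 -> 0 < L (p * p) by exact: weight_form_gt0.
have L_cheb0 n : ~~ (6 %| n)%N -> L (cheb R n) = 0.
  by rewrite /L /= weight_form_cheb => /negbTE ->.
have C0 : 18 * Num.sqrt 2 != 0 :> R by rewrite mulf_neq0// ?sqrtr_eq0 -?ltNge.
have [g1 g2 g3] := sieved_values C0 (@weight_form_cheb R) g0 gS.
have orth := sieved_orth L_cheb0 L_gt0 g0 gS.
pose P := recurrence_poly (sieved_gamma g).
exists (sieved_gamma g); split.
  by case=> // n _; exact: (sieved_gamma_gt0 L_cheb0 L_gt0 g0 gS).
split.
  split; first by rewrite (sieved_gamma1 g 0) g0 subr0.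
  split=> n; first by rewrite addn2 sieved_gamma2.
  have -> : (3 * n + 3 = 3 * n.+1)%N by lia.
  have -> : (3 * n + 4 = (3 * n.+1).+1)%N by lia.
  by rewrite sieved_gamma0 sieved_gamma1 subrKC.
split.
  rewrite (sieved_gamma0 g 1) (sieved_gamma1 g 1) (sieved_gamma0 g 2).
  rewrite (sieved_gamma1 g 2) (sieved_gamma0 g 3) (sieved_gamma1 g 3).
  rewrite g1 g2 g3; do ![split]; by field.
split.
- by move=> x h1 h2; exact: ltW (weight_gt0 h1 h2).
- by move=> n; have [] := size_recurrence_poly (sieved_gamma g) n.
- move=> m n; have := integrable_poly_weight (P m * P n).
  by congr (integrable _ _ _); apply/funext => x; rewrite /= hornerM.
- move=> m n mn; rewrite -[RHS](orth m n mn).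
  by apply: eq_Rintegral => x _; rewrite hornerM.
- move=> n; have /lt0r_neq0/eqP := L_gt0 _ (recurrence_poly_neq0 (sieved_gamma g) n).
  apply: contra_not => <-.
  by apply: eq_Rintegral => x _; rewrite hornerM expr2.
Qed.
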